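(* For $n=0,1,2,\dots$ let $$U_n=\sum_{k=0}^n\binom{2k}{k}^3\binom{2n-2k}{n-k}2^{4(n-k)},$$ which is a sequence of integers. Then the following identities are valid: $$\sum_{n=0}^\infty U_n\frac{(4n)!}{n!^2(2n)!}\,\frac{18n^2-10n-3}{(2^8 5^2)^n}=\frac{10\sqrt{5}}{\pi^2},$$ $$\sum_{n=0}^\infty U_n\frac{(4n)!}{n!^2(2n)!}\,\frac{1046529n^2+227104n+16032}{(5^4 41^2)^n}=\frac{5^4\cdot 41\sqrt{41}}{\pi^2},$$ and the sequence $U_n$ satisfies the recurrence relation $$(n+1)^3U_{n+1}-8(2n+1)(8n^2+8n+5)U_n+4096n^3U_{n-1}=0,\qquad n=1,2,\dots.$$
   Context: Here $n!^2$ denotes $(n!)^2$. *)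

(* Defs.v *)
From Stdlib Require Import Reals.

Open Scope R_scope.

(* [Binomial.C] is the Stdlib's real-valued binomial coefficient (it must be
   qualified, since Coquelicot uses [C] for the complex numbers);
   [sum_f_R0 f n] is f 0 + ... + f n.  The [nat] subtractions are exact for
   k <= n. *)
Definition U (n : nat) : R :=
  sum_f_R0 (fun k : nat =>
    Binomial.C (2 * k) k ^ 3 * Binomial.C (2 * n - 2 * k) (n - k)
      * 2 ^ (4 * (n - k))) n.

(* Main.v *)
Require Import Defs.
From Stdlib Require Import Reals Factorial Lra Lia Psatz.
From Coquelicot Require Import Coquelicot.
Open Scope R_scope.

(** The two series are images of Guillera's series
    [[
      sum (-1)^n c_n^5 (20n^2 + 8n + 1) / 4^n         = 8 / PI^2,
      sum (-1)^n c_n^5 (820n^2 + 180n + 13) / 1024^n  = 128 / PI^2,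
    ]]
    where c_n = C(2n,n)/4^n, under a quadratic transformation.  Put
    w = y / (1+y)^2 with 0 < y < 1.  Then 1 + y is the Catalan generating
    function at w, so y^m (1+y)^(1/2) = w^m (1+y)^(2m+1/2) is a power series in w
    with explicit positive coefficients ([ballot_generating]).  Inserting this in
    sum (-1)^m c_m^5 y^m (1+y)^(1/2) and collecting powers of w gives a
    power series whose n-th coefficient is a terminating very-well-poised
    sum.  By Whipple's transformation ([whipple_transformation]) that sum is
    U_n (4n)! / (n!^2 (2n)! 1024^n) ([ballot_transform_eq_U]).  Quadratic
    polynomial weights in n are carried along, since they act as differential
    operators in w ([ballot_transform_series]).  The values y = 1/4 and
    y = 1/1024 give the two series.

    Whipple's transformation is proved by creative telescoping: U_n / 64^n
    and the very-well-poised sum satisfy one and the same second-order recurrence.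
    For U_n this is also the recurrence claimed in the theorem.

    Guillera's series both come from one Wilf-Zeilberger pair ([wz_pair]),
    viewed as a closed discrete 1-form on the quarter plane.  The row
    k = 0 gives the first series and the staircase along the diagonal the
    second one; each is compared with a row far up, where only the term n = 0
    contributes, and its limit 8 / PI^2 is Wallis' product. *)

(** * Integrality of U and two sums with the same recurrence *)

(** The ratio C(2n,n)/4^n = (1/2)_n/n!, in recursive form because
    telescoping uses only the quotient of consecutive terms. *)
Fixpoint central (n : nat) : R :=
  match n with
  | O => 1
  | S k => central k * ((2 * INR k + 1) / (2 * INR k + 2))
  end.

Lemma central_S (n : nat) :
  central (S n) = central n * ((2 * INR n + 1) / (2 * INR n + 2)).
Proof. reflexivity. Qed.

Lemma central_pos (n : nat) : 0 < central n.
Proof.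
  induction n as [|n IH]; simpl central; [lra|].
  pose proof (pos_INR n).
  apply Rmult_lt_0_compat; [exact IH|apply Rdiv_lt_0_compat; lra].
Qed.

Lemma central_le_1 (n : nat) : central n <= 1.
Proof.
  induction n as [|n IH]; simpl central; [lra|].
  pose proof (pos_INR n). pose proof (central_pos n).
  assert ((2 * INR n + 1) / (2 * INR n + 2) <= 1)
    by (apply Rle_div_l; lra).
  assert (0 <= (2 * INR n + 1) / (2 * INR n + 2))
    by (apply Rlt_le, Rdiv_lt_0_compat; lra).
  nra.
Qed.

Lemma fact_S_INR (n : nat) : INR (fact (S n)) = (INR n + 1) * INR (fact n).
Proof. rewrite fact_simpl, mult_INR, S_INR; ring. Qed.

Lemma central_binomial (n : nat) : Binomial.C (2 * n) n = 4 ^ n * central n.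
Proof.
  unfold Binomial.C.
  replace (2 * n - n)%nat with n by lia.
  induction n as [|n IH].
  - simpl; field.
  - replace (2 * S n)%nat with (S (S (2 * n))) by lia.
    pose proof (pos_INR n). pose proof (INR_fact_neq_0 n).
    rewrite !fact_S_INR, S_INR, mult_INR.
    change (INR 2) with 2. simpl central. simpl pow.
    transitivity (INR (fact (2 * n)) / (INR (fact n) * INR (fact n))
        * ((2 * INR n + 1 + 1) * (2 * INR n + 1)
           / ((INR n + 1) * (INR n + 1)))).
    + field; lra.
    + rewrite IH. field; lra.
Qed.

Definition U_scaled (n : nat) : R :=
  sum_f_R0 (fun k => central k ^ 3 * central (n - k)) n.

Lemma U_eq_scaled (n : nat) : U n = 64 ^ n * U_scaled n.
Proof.
  unfold U, U_scaled. rewrite scal_sum. apply sum_eq. intros k Hk.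
  replace (2 * n - 2 * k)%nat with (2 * (n - k))%nat by lia.
  rewrite !central_binomial.
  replace (2 ^ (4 * (n - k))) with (16 ^ (n - k))
    by (rewrite pow_mult; f_equal; ring).
  replace (64 ^ n) with (64 ^ k * 64 ^ (n - k))
    by (rewrite <- pow_add; f_equal; lia).
  replace (64 ^ k) with ((4 ^ k) ^ 3)
    by (rewrite <- pow_mult, Nat.mul_comm, pow_mult; f_equal; ring).
  replace (64 ^ (n - k)) with (4 ^ (n - k) * 16 ^ (n - k))
    by (rewrite <- Rpow_mult_distr; f_equal; ring).
  ring.
Qed.

Lemma binomial_integer (n k : nat) :
  (k <= n)%nat -> exists z : Z, Binomial.C n k = IZR z.
Proof.
  assert (Hdiag : forall m, Binomial.C m m = 1).
  { intros m. unfold Binomial.C. rewrite Nat.sub_diag. simpl (INR (fact 0)).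
    field. apply INR_fact_neq_0. }
  revert k; induction n as [|n IH]; intros k Hk.
  - exists 1%Z. replace k with 0%nat by lia. apply Hdiag.
  - destruct k as [|k].
    + exists 1%Z. rewrite pascal_step1, Nat.sub_0_r by lia. apply Hdiag.
    + destruct (Nat.eq_dec k n) as [->|Hkn].
      * exists 1%Z. apply Hdiag.
      * rewrite <- pascal by lia.
        destruct (IH k ltac:(lia)) as [z1 ->].
        destruct (IH (S k) ltac:(lia)) as [z2 ->].
        exists (z1 + z2)%Z. now rewrite plus_IZR.
Qed.

Lemma sum_integer (f : nat -> R) (n : nat) :
  (forall k, (k <= n)%nat -> exists z : Z, f k = IZR z) ->
  exists z : Z, sum_f_R0 f n = IZR z.
Proof.
  induction n as [|n IH]; intros Hf; simpl sum_f_R0.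
  - apply Hf; lia.
  - destruct (IH ltac:(intros k Hk; apply Hf; lia)) as [z1 ->].
    destruct (Hf (S n) (le_n _)) as [z2 ->].
    exists (z1 + z2)%Z. now rewrite plus_IZR.
Qed.

Lemma U_integer (n : nat) : exists z : Z, U n = IZR z.
Proof.
  apply sum_integer. intros k Hk.
  destruct (binomial_integer (2 * k) k ltac:(lia)) as [z1 ->].
  destruct (binomial_integer (2 * n - 2 * k) (n - k) ltac:(lia)) as [z2 ->].
  exists (z1 ^ 3 * z2 * 2 ^ Z.of_nat (4 * (n - k)))%Z.
  rewrite !mult_IZR. rewrite (pow_IZR z1 3), (pow_IZR 2). reflexivity.
Qed.

(** Creative telescoping for sums over a triangle: a certificate [g] turns the
    second-order combination of the summands into a difference.  Beyond the
    diagonal the summands would be zero by convention; here the entries next to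
    the diagonal are listed in the last hypothesis instead, so that [g] is only
    used where it has no pole. *)
Lemma telescoping_recurrence (t : nat -> nat -> R) (g : nat -> R) (p : nat)
    (A B C : R) :
  (forall k, (k <= p)%nat ->
     A * t (S (S p)) k - B * t (S p) k + C * t p k = g (S k) - g k) ->
  g 0%nat = 0 ->
  g (S p) + A * (t (S (S p)) (S p) + t (S (S p)) (S (S p)))
    - B * t (S p) (S p) = 0 ->
  A * sum_f_R0 (t (S (S p))) (S (S p)) - B * sum_f_R0 (t (S p)) (S p)
    + C * sum_f_R0 (t p) p = 0.
Proof.
  intros Hstep H0 Hend.
  assert (Htel : forall q, (q <= p)%nat ->
    A * sum_f_R0 (t (S (S p))) q - B * sum_f_R0 (t (S p)) q
      + C * sum_f_R0 (t p) q = g (S q)).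
  { induction q as [|q IH]; intros Hq; simpl sum_f_R0.
    - rewrite Hstep by lia. lra.
    - pose proof (Hstep (S q) Hq). pose proof (IH ltac:(lia)). lra. }
  pose proof (Htel p (le_n p)). simpl sum_f_R0 in *. lra.
Qed.

Definition second_coeff (x : R) : R := (2 * x + 1) * (8 * x ^ 2 + 8 * x + 5) / 8.

(** The recurrence for U_n divided by 64^n, with index n = p + 1.  Both sides of
    the transformation below satisfy it, and its leading coefficient never
    vanishes. *)
Definition apery_like (v : nat -> R) : Prop :=
  forall p : nat,
    (INR p + 2) ^ 3 * v (S (S p)) - second_coeff (INR p + 1) * v (S p)
      + (INR p + 1) ^ 3 * v p = 0.

Lemma apery_like_unique (v w : nat -> R) :
  apery_like v -> apery_like w -> v 0%nat = w 0%nat -> v 1%nat = w 1%nat ->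
  forall n, v n = w n.
Proof.
  intros Hv Hw H0 H1.
  assert (forall n, v n = w n /\ v (S n) = w (S n)) as H.
  { induction n as [|n [IH1 IH2]]; [now split|].
    split; [exact IH2|].
    pose proof (Hv n) as Ev. pose proof (Hw n) as Ew.
    rewrite IH1, IH2 in Ev. pose proof (pos_INR n).
    apply (Rmult_eq_reg_l ((INR n + 2) ^ 3)); [lra|].
    apply pow_nonzero; lra. }
  intros n; apply H.
Qed.

(** The certificate comes from Zeilberger's algorithm: with the denominators
    cleared, the equation for a polynomial multiplier of
    k^3 / (n - k + 1) times the summand has the constant solution 1/2. *)
Lemma U_scaled_recurrence : apery_like U_scaled.
Proof.
  intros p. unfold U_scaled.
  apply (telescoping_recurrence (fun n k => central k ^ 3 * central (n - k))
    (fun k => INR k ^ 3 / (2 * (INR (S p) - INR k + 1))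
              * (central k ^ 3 * central (S p - k)))).
  - intros k Hk. destruct (Nat.le_exists_sub k p Hk) as [j [-> _]].
    replace (S (S (j + k)) - k)%nat with (S (S j)) by lia.
    replace (S (j + k) - k)%nat with (S j) by lia.
    replace (S (j + k) - S k)%nat with j by lia.
    replace (j + k - k)%nat with j by lia.
    pose proof (pos_INR j). pose proof (pos_INR k).
    unfold second_coeff. rewrite ?central_S, !S_INR, plus_INR. field. lra.
  - simpl INR; unfold Rdiv; ring.
  - rewrite Nat.sub_diag. replace (S (S p) - S p)%nat with 1%nat by lia.
    rewrite Nat.sub_diag.
    pose proof (pos_INR p).
    unfold second_coeff. rewrite !central_S, !S_INR.
    simpl (INR 0). simpl (central 0). field. lra.
Qed.

Fixpoint rising (a : R) (n : nat) : R :=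
  match n with
  | O => 1
  | S k => rising a k * (a + INR k)
  end.

Lemma rising_S (a : R) (n : nat) :
  rising a (S n) = rising a n * (a + INR n).
Proof. reflexivity. Qed.

Lemma rising_pos (a : R) (n : nat) : 0 < a -> 0 < rising a n.
Proof.
  intros Ha. induction n as [|n IH]; simpl rising; [lra|].
  pose proof (pos_INR n). apply Rmult_lt_0_compat; lra.
Qed.

(** The summand of a terminating very-well-poised 7F6(1) with parameters
    1/2, 5/4, 1/2, 1/2, 1/2, 1/2, -n; the factor 4m + 1 is the very-well-poised
    part. *)
Definition whipple_term (n m : nat) : R :=
  (4 * INR m + 1) * (-1) ^ m * central m ^ 5
    * (INR (fact n) ^ 2 / (INR (fact (n - m)) * rising (3 / 2) (n + m))).

Definition whipple_sum (n : nat) : R := sum_f_R0 (whipple_term n) n.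

(** As for [U_scaled_recurrence], Zeilberger's algorithm ends with a constant
    multiplier, here -2, of m^5 / ((4m + 1)(n - m + 1)) times the summand. *)
Lemma whipple_sum_recurrence : apery_like whipple_sum.
Proof.
  intros p. unfold whipple_sum.
  apply (telescoping_recurrence whipple_term
    (fun m => -2 * INR m ^ 5 / ((4 * INR m + 1) * (INR (S p) - INR m + 1))
              * whipple_term (S p) m)); unfold whipple_term.
  - intros k Hk. destruct (Nat.le_exists_sub k p Hk) as [j [-> _]].
    replace (S (S (j + k)) - k)%nat with (S (S j)) by lia.
    replace (S (j + k) - k)%nat with (S j) by lia.
    replace (S (j + k) - S k)%nat with j by lia.
    replace (j + k - k)%nat with j by lia.
    replace (S (j + k) + S k)%nat with (S (S (j + k + k))) by lia.
    change (S (S (j + k)) + k)%nat with (S (S (j + k + k))).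
    change (S (j + k) + k)%nat with (S (j + k + k)).
    pose proof (pos_INR j). pose proof (pos_INR k).
    pose proof (INR_fact_neq_0 j). pose proof (INR_fact_neq_0 (j + k)).
    pose proof (rising_pos (3/2) (j + k + k) ltac:(lra)).
    unfold second_coeff. rewrite ?central_S, ?rising_S, <- ?tech_pow_Rmult.
    rewrite !fact_S_INR, !S_INR, !plus_INR. field.
    repeat split; lra.
  - simpl INR; unfold Rdiv; ring.
  - rewrite !Nat.sub_diag. replace (S (S p) - S p)%nat with 1%nat by lia.
    replace (S (S p) + S (S p))%nat with (S (S (S (S (p + p))))) by lia.
    replace (S (S p) + S p)%nat with (S (S (S (p + p)))) by lia.
    replace (S p + S p)%nat with (S (S (p + p))) by lia.
    pose proof (pos_INR p). pose proof (INR_fact_neq_0 p).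
    pose proof (rising_pos (3/2) (p + p) ltac:(lra)).
    unfold second_coeff. rewrite ?central_S, ?rising_S, <- ?tech_pow_Rmult.
    rewrite !fact_S_INR, !S_INR, plus_INR. simpl (INR (fact 0)). simpl (INR 0). field.
    repeat split; lra.
Qed.

(** This instance of Whipple's transformation of a very-well-poised 7F6 into a
    balanced 4F3 holds because both sums obey the same second-order
    recurrence and agree at n = 0 and n = 1. *)
Lemma whipple_transformation (n : nat) : U_scaled n = whipple_sum n.
Proof.
  apply apery_like_unique; [apply U_scaled_recurrence|apply whipple_sum_recurrence| |];
    unfold U_scaled, whipple_sum, whipple_term; simpl; field.
Qed.

(** * Powers of the Catalan generating function *)

(** The ballot-type number r/(2k+r) * C(2k+r, k) for real r, the coefficient of
    w^k in the r-th power of the Catalan generating function.  The recursive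
    form makes the hypergeometric ratio of consecutive coefficients available
    without Gamma functions. *)
Fixpoint ballot (r : R) (k : nat) : R :=
  match k with
  | O => 1
  | S j => ballot r j * ((2 * INR j + r) * (2 * INR j + r + 1)
                         / ((INR j + 1) * (INR j + r + 1)))
  end.

Lemma ballot_S (r : R) (j : nat) :
  ballot r (S j) = ballot r j * ((2 * INR j + r) * (2 * INR j + r + 1)
                         / ((INR j + 1) * (INR j + r + 1))).
Proof. reflexivity. Qed.

Lemma ballot_pos (r : R) (k : nat) : 0 < r -> 0 < ballot r k.
Proof.
  intros Hr. induction k as [|k IH]; [simpl; lra|].
  rewrite ballot_S. pose proof (pos_INR k).
  apply Rmult_lt_0_compat; [exact IH|].
  apply Rdiv_lt_0_compat; apply Rmult_lt_0_compat; lra.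
Qed.

(** The weight 2k + r is chosen because for r = 2m + 1/2 it equals
    2(m + k) + 1/2, which depends only on the total index m + k. *)
Definition ballot_moment_coeff (r : R) (p k : nat) : R :=
  (2 * INR k + r) ^ p * ballot r k.

Lemma ballot_moment_coeff_pos (r : R) (p k : nat) :
  0 < r -> 0 < ballot_moment_coeff r p k.
Proof.
  intros Hr. pose proof (pos_INR k). apply Rmult_lt_0_compat.
  - apply pow_lt; lra.
  - now apply ballot_pos.
Qed.

Lemma lim_inv_shift (c : R) :
  0 < c -> is_lim_seq (fun k => / (INR k + c)) 0.
Proof.
  intros Hc. replace (Finite 0) with (Rbar_inv p_infty) by reflexivity.
  apply is_lim_seq_inv; [|discriminate].
  apply is_lim_seq_le_p_loc with INR; [|apply is_lim_seq_INR].
  exists 0%nat. intros k _. lra.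
Qed.

Lemma lim_shift_quotient (c d : R) :
  0 < d -> is_lim_seq (fun k => (INR k + c) / (INR k + d)) 1.
Proof.
  intros Hd.
  apply is_lim_seq_ext with (fun k => 1 + (c - d) * / (INR k + d)).
  { intros k. pose proof (pos_INR k). field. lra. }
  replace (Finite 1) with (Finite (1 + (c - d) * 0)) by (f_equal; ring).
  apply is_lim_seq_plus'; [apply is_lim_seq_const|].
  apply is_lim_seq_mult'; [apply is_lim_seq_const|].
  now apply lim_inv_shift.
Qed.

Lemma lim_pow (x : nat -> R) (l : R) (p : nat) :
  is_lim_seq x l -> is_lim_seq (fun k => x k ^ p) (l ^ p).
Proof.
  intros Hx. induction p as [|p IH]; simpl; [apply is_lim_seq_const|].
  now apply is_lim_seq_mult'.
Qed.

Lemma ballot_moment_radius (r : R) (p : nat) :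
  0 < r -> CV_radius (ballot_moment_coeff r p) = Finite (/ 4).
Proof.
  intros Hr. apply CV_radius_finite_DAlembert; [|lra|].
  - intros k. apply Rgt_not_eq, ballot_moment_coeff_pos, Hr.
  - apply is_lim_seq_ext with (fun k =>
      4 * ((INR k + r / 2) / (INR k + 1)
           * ((INR k + (r + 1) / 2) / (INR k + (r + 1))))
      * ((INR k + (r / 2 + 1)) / (INR k + r / 2)) ^ p).
    + intros k. pose proof (pos_INR k). symmetry.
      rewrite Rabs_pos_eq
        by (apply Rlt_le, Rdiv_lt_0_compat; now apply ballot_moment_coeff_pos).
      unfold ballot_moment_coeff. rewrite ballot_S, S_INR.
      pose proof (ballot_pos r k Hr).
      replace (2 * (INR k + 1) + r) with (2 * (INR k + (r / 2 + 1))) by lra.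
      replace (2 * INR k + r) with (2 * (INR k + r / 2)) by lra.
      replace (((INR k + (r / 2 + 1)) / (INR k + r / 2)) ^ p)
        with ((INR k + (r / 2 + 1)) ^ p / (INR k + r / 2) ^ p)
        by (unfold Rdiv; rewrite Rpow_mult_distr, pow_inv; reflexivity).
      rewrite !Rpow_mult_distr.
      assert (2 ^ p <> 0) by (apply pow_nonzero; lra).
      assert ((INR k + r / 2) ^ p <> 0) by (apply pow_nonzero; lra).
      field. repeat split; try assumption; lra.
    + replace (Finite 4) with (Finite (4 * (1 * 1) * 1 ^ p))
        by (f_equal; rewrite pow1; ring).
      apply is_lim_seq_mult'; [|apply lim_pow, lim_shift_quotient; lra].
      apply is_lim_seq_mult'; [apply is_lim_seq_const|].
      apply is_lim_seq_mult'; apply lim_shift_quotient; lra.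
Qed.

Definition ballot_moment (r : R) (p : nat) (w : R) : R :=
  PSeries (ballot_moment_coeff r p) w.

Definition ballot_moment' (r : R) (p : nat) (w : R) : R :=
  PSeries (PS_derive (ballot_moment_coeff r p)) w.

Lemma ballot_inside (r : R) (p : nat) (w : R) :
  0 < r -> Rabs w < / 4 ->
  Rbar_lt (Rabs w) (CV_radius (ballot_moment_coeff r p)).
Proof. intros Hr Hw. now rewrite ballot_moment_radius. Qed.

Lemma ballot_moment_is_derive (r : R) (p : nat) (w : R) :
  0 < r -> Rabs w < / 4 ->
  is_derive (ballot_moment r p) w (ballot_moment' r p w).
Proof. intros Hr Hw. apply is_derive_PSeries, ballot_inside; assumption. Qed.

(** The Euler operator w d/dw multiplies the k-th coefficient by
    k = ((2k + r) - r) / 2, hence links consecutive moments. *)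
Lemma ballot_moment_euler (r : R) (p : nat) (w : R) :
  0 < r -> Rabs w < / 4 ->
  w * ballot_moment' r p w
  = (ballot_moment r (S p) w - r * ballot_moment r p w) / 2.
Proof.
  intros Hr Hw. unfold ballot_moment', ballot_moment.
  assert (Hex : forall q, ex_pseries (ballot_moment_coeff r q) w)
    by (intros q; now apply CV_radius_inside, ballot_inside).
  transitivity (/ 2 * PSeries (ballot_moment_coeff r (S p)) w
                + - r / 2 * PSeries (ballot_moment_coeff r p) w); [|field].
  rewrite <- PSeries_incr_1, <- !PSeries_scal, <- PSeries_plus
    by (apply ex_pseries_scal; [apply Rmult_comm|apply Hex]).
  apply PSeries_ext. intros [|k].
  - change (0 = / 2 * ((2 * 0 + r) * (2 * 0 + r) ^ p * 1)
                + - r / 2 * ((2 * 0 + r) ^ p * 1)). field.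
  - set (c := ballot_moment_coeff r p (S k)).
    change (INR (S k) * c
      = / 2 * ((2 * INR (S k) + r) * (2 * INR (S k) + r) ^ p * ballot r (S k))
        + - r / 2 * c).
    unfold c, ballot_moment_coeff. field.
Qed.

(** From (2k+2+r)^2 - r^2 = 4(k+1)(k+1+r), which cancels the denominator of the
    coefficient ratio: this is the hypergeometric differential equation. *)
Lemma ballot_moment_hypergeometric (r : R) (w : R) :
  0 < r -> Rabs w < / 4 ->
  ballot_moment r 2 w - r ^ 2 * ballot_moment r 0 w
  = 4 * w * (ballot_moment r 2 w + ballot_moment r 1 w).
Proof.
  intros Hr Hw.
  assert (Hex : forall p, ex_pseries (ballot_moment_coeff r p) w)
    by (intros p; now apply CV_radius_inside, ballot_inside).
  unfold ballot_moment.
  transitivity (PSeries (ballot_moment_coeff r 2) w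
                + - r ^ 2 * PSeries (ballot_moment_coeff r 0) w); [ring|].
  transitivity (w * (4 * (PSeries (ballot_moment_coeff r 2) w
                          + PSeries (ballot_moment_coeff r 1) w))); [|ring].
  assert (Hscal : ex_pseries (PS_scal (- r ^ 2) (ballot_moment_coeff r 0)) w)
    by (apply ex_pseries_scal; [apply Rmult_comm|exact (Hex 0%nat)]).
  rewrite <- (PSeries_scal (- r ^ 2)),
    <- (PSeries_plus _ _ _ (Hex 2%nat) Hscal),
    <- (PSeries_plus _ _ _ (Hex 2%nat) (Hex 1%nat)),
    <- (PSeries_scal 4), <- PSeries_incr_1.
  apply PSeries_ext. intros [|k].
  - change ((2 * 0 + r) ^ 2 * 1 + - r ^ 2 * ((2 * 0 + r) ^ 0 * 1) = 0). ring.
  - change ((2 * INR (S k) + r) ^ 2 * ballot r (S k)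
            + - r ^ 2 * ((2 * INR (S k) + r) ^ 0 * ballot r (S k))
            = 4 * ((2 * INR k + r) ^ 2 * ballot r k
                   + (2 * INR k + r) ^ 1 * ballot r k)).
    rewrite ballot_S, S_INR. pose proof (pos_INR k). field. lra.
Qed.

Lemma ballot_moment_0 (r : R) (p : nat) : ballot_moment r p 0 = r ^ p.
Proof.
  unfold ballot_moment. rewrite PSeries_0. unfold ballot_moment_coeff; simpl.
  rewrite Rmult_0_r, Rplus_0_l. ring.
Qed.

(** With s = 2 w d/dw + r and D = sqrt (1 - 4w), the hypergeometric equation
    factors as (D s - r)(D s + r) = 0.  Hence chi = (D s - r) applied to the
    generating function solves a first-order equation whose coefficient is
    negative for w > 0, so chi^2 is nonincreasing there; as chi(0) = 0, chi
    vanishes. *)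
Lemma ballot_first_moment (r w : R) :
  0 < r -> 0 <= w < / 4 ->
  sqrt (1 - 4 * w) * ballot_moment r 1 w = r * ballot_moment r 0 w.
Proof.
  intros Hr Hw.
  set (chi := fun x => sqrt (1 - 4 * x) * ballot_moment r 1 x
                       - r * ballot_moment r 0 x).
  set (chi' := fun x => - 2 / sqrt (1 - 4 * x) * ballot_moment r 1 x
                        + sqrt (1 - 4 * x) * ballot_moment' r 1 x
                       - r * ballot_moment' r 0 x).
  assert (Hder : forall x, 0 <= x < / 4 -> is_derive chi x (chi' x)).
  { intros x Hx. assert (Hx' : Rabs x < / 4) by (rewrite Rabs_pos_eq; lra).
    apply (is_derive_minus (fun x => sqrt (1 - 4 * x) * ballot_moment r 1 x)
             (fun x => r * ballot_moment r 0 x)).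
    - apply (is_derive_mult (fun x => sqrt (1 - 4 * x)) (ballot_moment r 1));
        [|now apply ballot_moment_is_derive|apply Rmult_comm].
      auto_derive; [lra|]. replace (1 + - (4 * x)) with (1 - 4 * x) by ring.
      field. apply Rgt_not_eq, sqrt_lt_R0; lra.
    - apply is_derive_scal. now apply ballot_moment_is_derive. }
  assert (Hode : forall x, 0 <= x < / 4 ->
    x * chi' x = - (r / 2 * (1 + / sqrt (1 - 4 * x))) * chi x).
  { intros x Hx. assert (Hx' : Rabs x < / 4) by (rewrite Rabs_pos_eq; lra).
    unfold chi', chi.
    pose proof (ballot_moment_euler r 0 x Hr Hx') as E0.
    pose proof (ballot_moment_euler r 1 x Hr Hx') as E1.
    pose proof (ballot_moment_hypergeometric r x Hr Hx') as E2.
    assert (HD : 0 < sqrt (1 - 4 * x)) by (apply sqrt_lt_R0; lra).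
    assert (HD2 : sqrt (1 - 4 * x) * sqrt (1 - 4 * x) = 1 - 4 * x)
      by (apply sqrt_sqrt; lra).
    set (D := sqrt (1 - 4 * x)) in *.
    replace (x * (-2 / D * ballot_moment r 1 x + D * ballot_moment' r 1 x
                  - r * ballot_moment' r 0 x))
      with (x * (-2 / D * ballot_moment r 1 x) + D * (x * ballot_moment' r 1 x)
                  - r * (x * ballot_moment' r 0 x)) by ring.
    rewrite E0, E1. apply (Rmult_eq_reg_l (2 * D)); [|lra].
    assert (Hkey : D * D * ballot_moment r 2 x - 4 * x * ballot_moment r 1 x
                   = r ^ 2 * ballot_moment r 0 x) by (rewrite HD2; lra).
    transitivity (D * D * ballot_moment r 2 x - 4 * x * ballot_moment r 1 x
      - (D * D * r * ballot_moment r 1 x + r * D * ballot_moment r 1 x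
         - r ^ 2 * D * ballot_moment r 0 x)).
    - field; lra.
    - rewrite Hkey. field; lra. }
  destruct (Req_dec (chi w) 0) as [E|NE]; [unfold chi in E; lra|exfalso].
  assert (H0 : chi 0 = 0).
  { unfold chi. rewrite !ballot_moment_0, Rmult_0_r, Rminus_0_r, sqrt_1. ring. }
  assert (Hw0 : 0 < w).
  { destruct (Req_dec w 0) as [->|]; [contradiction|lra]. }
  destruct (MVT_gen (fun x => chi x * chi x) 0 w
              (fun x => 2 * (chi x * chi' x))) as [c [Hc Hmvt]].
  - rewrite Rmin_left, Rmax_right by lra. intros x Hx.
    replace (2 * (chi x * chi' x)) with (chi' x * chi x + chi x * chi' x) by ring.
    apply (is_derive_mult chi chi); [apply Hder; lra|apply Hder; lra|apply Rmult_comm].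
  - rewrite Rmin_left, Rmax_right by lra. intros x Hx.
    apply continuity_pt_mult;
      apply derivable_continuous_pt; exists (chi' x); apply is_derive_Reals;
      apply Hder; lra.
  - rewrite Rmin_left, Rmax_right in Hc by lra.
    rewrite H0 in Hmvt.
    assert (0 < chi w * chi w) by (apply Rsqr_pos_lt; exact NE).
    assert (0 < / sqrt (1 - 4 * c))
      by (apply Rinv_0_lt_compat, sqrt_lt_R0; lra).
    destruct (Req_dec c 0) as [->|Hc0].
    { rewrite H0 in Hmvt. lra. }
    assert (Hneg : chi c * (c * chi' c) <= 0).
    { rewrite Hode by lra.
      assert (0 <= r / 2 * (1 + / sqrt (1 - 4 * c))) by (apply Rmult_le_pos; lra).
      pose proof (Rle_0_sqr (chi c)) as Hs; unfold Rsqr in Hs. nra. }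
    assert (0 < chi c * chi' c) by nra.
    nra.
Qed.

(** The first moment relation is a first-order linear equation for the
    generating function, solved by the r-th power of the Catalan function
    2 / (1 + sqrt (1 - 4w)). *)
Lemma ballot_generating (r w : R) :
  0 < r -> 0 <= w < / 4 ->
  ballot_moment r 0 w = exp (- r * ln ((1 + sqrt (1 - 4 * w)) / 2)).
Proof.
  intros Hr Hw.
  set (E := fun x => exp (r * ln ((1 + sqrt (1 - 4 * x)) / 2))).
  assert (HD : forall x, 0 <= x < / 4 -> 0 < sqrt (1 - 4 * x))
    by (intros x Hx; apply sqrt_lt_R0; lra).
  set (h' := fun x => ballot_moment' r 0 x * E x
     + ballot_moment r 0 x
       * (E x * (r * (- 2 / (sqrt (1 - 4 * x) * (1 + sqrt (1 - 4 * x))))))).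
  assert (Hder : forall x, 0 <= x < / 4 ->
    is_derive (fun x => ballot_moment r 0 x * E x) x (h' x)).
  { intros x Hx. assert (Hx' : Rabs x < / 4) by (rewrite Rabs_pos_eq; lra).
    pose proof (HD x Hx).
    apply (is_derive_mult (ballot_moment r 0) E);
      [now apply ballot_moment_is_derive| |apply Rmult_comm].
    unfold E. auto_derive.
    - split; [lra|]. split; [|trivial]. unfold Rminus in *. lra.
    - replace (1 + - (4 * x)) with (1 - 4 * x) by ring.
      unfold Rdiv. field. lra. }
  assert (Hzero : forall x, 0 < x < / 4 -> h' x = 0).
  { intros x Hx. assert (Hx' : Rabs x < / 4) by (rewrite Rabs_pos_eq; lra).
    pose proof (HD x ltac:(lra)).
    pose proof (ballot_moment_euler r 0 x Hr Hx') as E0.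
    pose proof (ballot_first_moment r x Hr ltac:(lra)) as E1.
    assert (HD2 : sqrt (1 - 4 * x) * sqrt (1 - 4 * x) = 1 - 4 * x)
      by (apply sqrt_sqrt; lra).
    unfold h'. set (D := sqrt (1 - 4 * x)) in *.
    assert (ballot_moment r 1 x = r * ballot_moment r 0 x / D) as E1'
      by (rewrite <- E1; field; lra).
    rewrite E1' in E0.
    assert (ballot_moment' r 0 x
            = (r * ballot_moment r 0 x / D - r * ballot_moment r 0 x) / 2 / x) as E0'
      by (rewrite <- E0; field; lra).
    rewrite E0'. replace x with ((1 - D * D) / 4) by lra.
    assert (1 - D * D <> 0) by lra.
    assert (1 - D <> 0) by (intros K; nra).
    field. repeat split; lra. }
  assert (Hconst : ballot_moment r 0 w * E w = 1).
  { destruct (Req_dec w 0) as [->|Hw0].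
    - rewrite ballot_moment_0. unfold E.
      rewrite Rmult_0_r, Rminus_0_r, sqrt_1.
      replace ((1 + 1) / 2) with 1 by field. rewrite ln_1, Rmult_0_r, exp_0. ring.
    - destruct (MVT_gen (fun x => ballot_moment r 0 x * E x) 0 w
                  (fun x => 0)) as [c [_ Hmvt]].
      + rewrite Rmin_left, Rmax_right by lra. intros x Hx.
        rewrite <- (Hzero x) by lra. apply Hder; lra.
      + rewrite Rmin_left, Rmax_right by lra. intros x Hx.
        apply derivable_continuous_pt; exists (h' x); apply is_derive_Reals.
        apply Hder; lra.
      + rewrite ballot_moment_0 in Hmvt. unfold E in Hmvt at 2.
        rewrite Rmult_0_r, Rminus_0_r, sqrt_1 in Hmvt.
        replace ((1 + 1) / 2) with 1 in Hmvt by field.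
        rewrite ln_1, Rmult_0_r, exp_0 in Hmvt. simpl in Hmvt. lra. }
  apply (Rmult_eq_reg_r (E w)); [|unfold E; apply Rgt_not_eq, exp_pos].
  rewrite Hconst. unfold E. rewrite <- exp_plus.
  replace (_ + _) with 0 by ring. now rewrite exp_0.
Qed.

(** * The quadratic transformation *)

Lemma is_series_sum_f_R0 (f : nat -> R) (l : R) :
  is_series f l <-> is_lim_seq (sum_f_R0 f) l.
Proof.
  split; intros H.
  - apply is_lim_seq_ext with (sum_n f); [apply sum_n_Reals|exact H].
  - change (is_lim_seq (sum_n f) l).
    apply is_lim_seq_ext with (sum_f_R0 f); [|exact H].
    intros n. symmetry. apply sum_n_Reals.
Qed.

Lemma lim_finite_sum (d : nat -> nat -> R) (K : nat) :
  (forall m, is_lim_seq (fun N => d N m) 0) ->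
  is_lim_seq (fun N => sum_f_R0 (d N) K) 0.
Proof.
  intros Hd. induction K as [|K IH]; simpl; [apply Hd|].
  replace (Finite 0) with (Finite (0 + 0)) by (f_equal; ring).
  apply is_lim_seq_plus'; [exact IH|apply Hd].
Qed.

(** Dominated convergence for sums whose length grows with the parameter: the
    terms beyond a fixed index are uniformly small by the majorant, and the
    finitely many others converge one by one. *)
Lemma tannery (d : nat -> nat -> R) (L M : nat -> R) (l : R) :
  (forall N m, (m <= N)%nat -> Rabs (d N m) <= M m) ->
  ex_series M ->
  (forall m, is_lim_seq (fun N => d N m) (L m)) ->
  is_series L l ->
  is_lim_seq (fun N => sum_f_R0 (d N) N) l.
Proof.
  intros Hdom [s HM] Hlim HL.
  apply is_series_sum_f_R0 in HM. apply is_series_sum_f_R0 in HL.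
  assert (HLM : forall m, Rabs (L m) <= M m).
  { intros m.
    apply (is_lim_seq_le_loc (fun N => Rabs (d N m)) (fun _ => M m)
             (Rabs (L m)) (M m)).
    - exists m. intros N HN. now apply Hdom.
    - apply (is_lim_seq_abs _ (L m)), Hlim.
    - apply is_lim_seq_const. }
  apply is_lim_seq_ext with
    (fun N => sum_f_R0 (fun m => d N m - L m) N + sum_f_R0 L N).
  { intros N. rewrite <- plus_sum. apply sum_eq. intros; ring. }
  replace (Finite l) with (Finite (0 + l)) by (f_equal; ring).
  apply is_lim_seq_plus'; [|exact HL].
  assert (Hhead : forall K,
    is_lim_seq (fun N => sum_f_R0 (fun m => Rabs (d N m - L m)) K) 0).
  { intros K. apply (lim_finite_sum (fun N m => Rabs (d N m - L m))).
    intros m. rewrite <- Rabs_R0. apply (is_lim_seq_abs _ 0).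
    replace (Finite 0) with (Finite (L m - L m)) by (f_equal; ring).
    apply is_lim_seq_minus'; [apply Hlim|apply is_lim_seq_const]. }
  assert (Htail : forall K N, (K <= N)%nat ->
    sum_f_R0 (fun m => Rabs (d N m - L m)) N
    <= sum_f_R0 (fun m => Rabs (d N m - L m)) K
       + 2 * (sum_f_R0 M N - sum_f_R0 M K)).
  { intros K N HKN.
    assert (Hgen : forall j, (K + j <= N)%nat ->
      sum_f_R0 (fun m => Rabs (d N m - L m)) (K + j)
      <= sum_f_R0 (fun m => Rabs (d N m - L m)) K
         + 2 * (sum_f_R0 M (K + j) - sum_f_R0 M K)).
    { induction j as [|j IH]; intros Hj.
      - rewrite Nat.add_0_r. lra.
      - rewrite <- plus_n_Sm. simpl sum_f_R0.
        pose proof (IH ltac:(lia)).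
        pose proof (Rabs_triang (d N (S (K + j))) (- L (S (K + j)))) as Ht.
        rewrite Rabs_Ropp in Ht.
        pose proof (Hdom N (S (K + j)) ltac:(lia)).
        pose proof (HLM (S (K + j))). unfold Rminus in *. lra. }
    pose proof (Hgen (N - K)%nat ltac:(lia)) as Hend.
    now replace (K + (N - K))%nat with N in Hend by lia. }
  apply is_lim_seq_spec. intros eps.
  apply is_lim_seq_spec in HM.
  assert (Hpos : 0 < eps / 8) by (pose proof (cond_pos eps); lra).
  destruct (HM (mkposreal _ Hpos)) as [K HK]. simpl in HK.
  pose proof (Hhead K) as HheadK. apply is_lim_seq_spec in HheadK.
  destruct (HheadK (mkposreal _ Hpos)) as [N1 HN1]. simpl in HN1.
  exists (max K N1). intros N HN.
  pose proof (Htail K N ltac:(lia)) as Ht.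
  pose proof (Rabs_def2 _ _ (HN1 N ltac:(lia))).
  pose proof (Rabs_def2 _ _ (HK N ltac:(lia))).
  pose proof (Rabs_def2 _ _ (HK K ltac:(lia))).
  rewrite Rminus_0_r.
  eapply Rle_lt_trans; [apply Rsum_abs|].
  pose proof (cond_pos eps). lra.
Qed.

(** Summing over antidiagonals or over columns of a finite triangle gives the
    same result; this is the only rearrangement used, so that no theory of
    double series is needed. *)
Lemma sum_triangle (f : nat -> nat -> R) (N : nat) :
  sum_f_R0 (fun n => sum_f_R0 (fun m => f m (n - m)%nat) n) N
  = sum_f_R0 (fun m => sum_f_R0 (f m) (N - m)) N.
Proof.
  induction N as [|N IH]; [reflexivity|].
  rewrite !tech5, IH, Nat.sub_diag, <- Rplus_assoc.
  simpl (sum_f_R0 (f (S N)) 0). f_equal.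
  rewrite <- plus_sum. apply sum_eq. intros m Hm.
  now replace (S N - m)%nat with (S (N - m)) by lia.
Qed.

Lemma polynomial_geometric_summable (c y : R) (p : nat) :
  0 < c -> 0 < y < 1 -> ex_series (fun m => (INR m + c) ^ p * y ^ m).
Proof.
  intros Hc Hy.
  assert (Hpos : forall m, 0 < (INR m + c) ^ p * y ^ m).
  { intros m. pose proof (pos_INR m).
    apply Rmult_lt_0_compat; apply pow_lt; lra. }
  apply ex_series_ext with (fun m => Rabs ((INR m + c) ^ p * y ^ m)).
  { intros m. apply Rabs_pos_eq, Rlt_le, Hpos. }
  apply ex_series_DAlembert with y; [lra| |].
  - intros m. apply Rgt_not_eq, Hpos.
  - apply is_lim_seq_ext with
      (fun m => ((INR m + (c + 1)) / (INR m + c)) ^ p * y).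
    + intros m. rewrite Rabs_pos_eq by (apply Rlt_le, Rdiv_lt_0_compat; apply Hpos).
      pose proof (pos_INR m). rewrite S_INR, <- tech_pow_Rmult.
      replace (INR m + 1 + c) with (INR m + (c + 1)) by ring.
      unfold Rdiv at 1. rewrite Rpow_mult_distr, pow_inv.
      field. split; apply pow_nonzero; lra.
    + replace (Finite y) with (Finite (1 ^ p * y))
        by (f_equal; rewrite pow1; ring).
      apply is_lim_seq_mult'; [|apply is_lim_seq_const].
      now apply lim_pow, lim_shift_quotient.
Qed.

(** The parametrisation under which sqrt (1 - 4w) is rational in y and the
    Catalan generating function at w is 1 + y. *)
Definition catalan_argument (y : R) : R := y / (1 + y) ^ 2.

Lemma catalan_argument_bounds (y : R) :
  0 < y < 1 -> 0 < catalan_argument y < / 4.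
Proof.
  intros Hy. unfold catalan_argument. split.
  - apply Rdiv_lt_0_compat; [lra|apply pow_lt; lra].
  - apply Rlt_div_l; [apply pow_lt; lra|nra].
Qed.

Lemma catalan_sqrt (y : R) :
  0 < y < 1 -> sqrt (1 - 4 * catalan_argument y) = (1 - y) / (1 + y).
Proof.
  intros Hy. unfold catalan_argument.
  replace (1 - 4 * (y / (1 + y) ^ 2)) with (((1 - y) / (1 + y)) ^ 2)
    by (field; lra).
  apply sqrt_pow2. apply Rlt_le, Rdiv_lt_0_compat; lra.
Qed.

Lemma ballot_moment_0_closed (y : R) (m : nat) :
  0 < y < 1 ->
  let w := catalan_argument y in
  w ^ m * ballot_moment (2 * INR m + / 2) 0 w = y ^ m * sqrt (1 + y).
Proof.
  intros Hy w.
  pose proof (pos_INR m). pose proof (catalan_argument_bounds y Hy) as Hw.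
  rewrite ballot_generating by (fold w in Hw; lra).
  unfold w at 2. rewrite catalan_sqrt by exact Hy.
  replace ((1 + (1 - y) / (1 + y)) / 2) with (/ (1 + y)) by (field; lra).
  rewrite ln_Rinv by lra.
  replace (- (2 * INR m + / 2) * - ln (1 + y))
    with (INR (2 * m) * ln (1 + y) + / 2 * ln (1 + y))
    by (rewrite mult_INR; simpl (INR 2); ring).
  rewrite exp_plus.
  change (exp (INR (2 * m) * ln (1 + y))) with (Rpower (1 + y) (INR (2 * m))).
  change (exp (/ 2 * ln (1 + y))) with (Rpower (1 + y) (/ 2)).
  rewrite Rpower_pow, Rpower_sqrt, pow_mult by lra.
  rewrite <- Rmult_assoc, <- Rpow_mult_distr. f_equal. f_equal.
  unfold w, catalan_argument. field. lra.
Qed.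

Lemma ballot_moment_1_closed (y r : R) :
  0 < y < 1 -> 0 < r ->
  let w := catalan_argument y in
  let D := (1 - y) / (1 + y) in
  ballot_moment r 1 w = r / D * ballot_moment r 0 w.
Proof.
  intros Hy Hr w D. pose proof (catalan_argument_bounds y Hy) as Hw.
  assert (HD : 0 < D) by (apply Rdiv_lt_0_compat; lra).
  pose proof (ballot_first_moment r w Hr ltac:(fold w in Hw; lra)) as E.
  unfold w at 1 in E. rewrite catalan_sqrt in E by exact Hy. fold D in E.
  apply (Rmult_eq_reg_l D); [|lra]. rewrite E. field. lra.
Qed.

Lemma ballot_moment_2_closed (y r : R) :
  0 < y < 1 -> 0 < r ->
  let w := catalan_argument y in
  let D := (1 - y) / (1 + y) in
  ballot_moment r 2 w
  = (r ^ 2 / D ^ 2 + 4 * w * r / D ^ 3) * ballot_moment r 0 w.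
Proof.
  intros Hy Hr w D. pose proof (catalan_argument_bounds y Hy) as Hw. fold w in Hw.
  assert (HD : 0 < D) by (apply Rdiv_lt_0_compat; lra).
  pose proof (ballot_moment_hypergeometric r w Hr
                ltac:(rewrite Rabs_pos_eq; lra)) as E.
  pose proof (ballot_moment_1_closed y r Hy Hr) as E1.
  cbv zeta in E1. fold w D in E1. rewrite E1 in E.
  assert (HD2 : D ^ 2 = 1 - 4 * w)
    by (unfold D, w, catalan_argument; field; lra).
  apply (Rmult_eq_reg_l (D ^ 2)); [|apply pow_nonzero; lra].
  transitivity (r ^ 2 * ballot_moment r 0 w
                + 4 * w * (r / D * ballot_moment r 0 w)).
  - rewrite HD2. lra.
  - field. lra.
Qed.

Definition ballot_transform (n : nat) : R :=
  sum_f_R0 (fun m => (-1) ^ m * central m ^ 5 * ballot (2 * INR m + / 2) (n - m)) n.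

(** The quadratic transformation, in the direction in which it needs no analytic
    continuation.  Expanding y^m (1+y)^(1/2) in powers of w has positive
    coefficients, so the rearrangement is dominated on the whole interval
    0 < y < 1; expanding in powers of y instead would diverge at y = 1/4.
    The polynomial hypothesis expresses how a quadratic weight in the outer
    index is transported: by the closed forms of the moments it becomes, after
    division by y^m sqrt (1+y), a quadratic polynomial in m. *)
Lemma ballot_transform_series (y al be ga ka a b c l : R) :
  0 < y < 1 ->
  let w := catalan_argument y in
  let D := (1 - y) / (1 + y) in
  (forall x,
     al * ((2 * x + / 2) ^ 2 / D ^ 2 + 4 * w * (2 * x + / 2) / D ^ 3)
     + be * ((2 * x + / 2) / D) + ga = ka * (a * x ^ 2 + b * x + c)) ->
  is_series (fun m => (-1) ^ m * central m ^ 5 * y ^ m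
                      * (a * INR m ^ 2 + b * INR m + c)) l ->
  is_series (fun n => ballot_transform n * w ^ n
      * (al * (2 * INR n + / 2) ^ 2 + be * (2 * INR n + / 2) + ga))
    (ka * sqrt (1 + y) * l).
Proof.
  intros Hy w D Hpoly Hser.
  pose proof (catalan_argument_bounds y Hy) as Hw. fold w in Hw.
  set (q := fun s => al * s ^ 2 + be * s + ga).
  set (r := fun m => 2 * INR m + / 2).
  assert (Hr : forall m, / 2 <= r m)
    by (intros m; unfold r; pose proof (pos_INR m); lra).
  set (part := fun m k => q (2 * INR k + r m) * ballot (r m) k * w ^ k).
  set (d := fun N m => (-1) ^ m * central m ^ 5 * w ^ m * sum_f_R0 (part m) (N - m)).
  apply is_series_sum_f_R0.
  apply is_lim_seq_ext with (fun N => sum_f_R0 (d N) N).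
  { intros N. unfold d.
    transitivity (sum_f_R0 (fun m => sum_f_R0 (fun k =>
      (-1) ^ m * central m ^ 5 * w ^ m * part m k) (N - m)) N).
    { apply sum_eq. intros m Hm. rewrite scal_sum. apply sum_eq. intros; ring. }
    rewrite <- sum_triangle. apply sum_eq. intros n Hn.
    unfold ballot_transform. 
    rewrite Rmult_assoc, Rmult_comm, scal_sum. apply sum_eq. intros m Hm.
    unfold part, q, r.
    replace (w ^ n) with (w ^ m * w ^ (n - m))
      by (rewrite <- pow_add; f_equal; lia).
    replace (2 * INR (n - m) + (2 * INR m + / 2)) with (2 * INR n + / 2)
      by (rewrite minus_INR by lia; ring).
    ring. }
  (* Since s >= 1/2, one has s <= 2 s^2 and 1 <= 4 s^2. *)
  set (A := Rabs al + 2 * Rabs be + 4 * Rabs ga).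
  assert (HA : 0 <= A)
    by (unfold A; pose proof (Rabs_pos al); pose proof (Rabs_pos be);
        pose proof (Rabs_pos ga); lra).
  assert (Hq : forall s, / 2 <= s -> Rabs (q s) <= A * s ^ 2).
  { intros s Hs. unfold q, A.
    eapply Rle_trans; [apply Rabs_triang|].
    eapply Rle_trans; [apply Rplus_le_compat_r, Rabs_triang|].
    rewrite !Rabs_mult, (Rabs_pos_eq s), (Rabs_pos_eq (s ^ 2)) by nra.
    pose proof (Rabs_pos al); pose proof (Rabs_pos be);
      pose proof (Rabs_pos ga).
    assert (s <= 2 * s ^ 2) by nra.
    assert (1 <= 4 * s ^ 2) by nra.
    nra. }
  assert (Hmom : forall m p,
    is_series (fun k => (2 * INR k + r m) ^ p * ballot (r m) k * w ^ k)
      (ballot_moment (r m) p w)).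
  { intros m p. pose proof (Hr m).
    apply is_series_ext with
      (fun k => scal (pow_n w k) (ballot_moment_coeff (r m) p k)).
    - intros k. rewrite pow_n_pow. unfold ballot_moment_coeff.
      change (w ^ k * ((2 * INR k + r m) ^ p * ballot (r m) k)
              = (2 * INR k + r m) ^ p * ballot (r m) k * w ^ k). ring.
    - apply PSeries_correct, CV_radius_inside, ballot_inside; [lra|].
      rewrite Rabs_pos_eq; lra. }
  apply tannery with
    (L := fun m => ka * sqrt (1 + y) * ((-1) ^ m * central m ^ 5 * y ^ m
                   * (a * INR m ^ 2 + b * INR m + c)))
    (M := fun m => A * (w ^ m * ballot_moment (r m) 2 w)).
  - intros N m _. unfold d.
    rewrite !Rabs_mult, pow_1_abs, Rmult_1_l.
    pose proof (central_pos m). pose proof (central_le_1 m).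
    assert (Hwm : 0 < w ^ m) by (apply pow_lt; lra).
    rewrite (Rabs_pos_eq (w ^ m)), (Rabs_pos_eq (central m ^ 5))
      by (try apply pow_le; lra).
    assert (central m ^ 5 <= 1) by (rewrite <- (pow1 5); apply pow_incr; lra).
    assert (0 <= central m ^ 5) by (apply pow_le; lra).
    assert (HS : Rabs (sum_f_R0 (part m) (N - m))
                 <= A * ballot_moment (r m) 2 w).
    { eapply Rle_trans; [apply Rsum_abs|].
      apply Rle_trans with (sum_f_R0 (fun k =>
        (2 * INR k + r m) ^ 2 * ballot (r m) k * w ^ k * A) (N - m)).
      - apply sum_Rle. intros k _. unfold part.
        pose proof (Hr m). pose proof (pos_INR k).
        pose proof (ballot_pos (r m) k ltac:(lra)).
        assert (0 < w ^ k) by (apply pow_lt; lra).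
        rewrite !Rabs_mult, (Rabs_pos_eq (ballot _ _)), (Rabs_pos_eq (w ^ k))
          by lra.
        pose proof (Hq (2 * INR k + r m) ltac:(lra)).
        assert (0 < ballot (r m) k * w ^ k) by now apply Rmult_lt_0_compat.
        nra.
      - rewrite <- scal_sum. apply Rmult_le_compat_l; [exact HA|].
        apply (sum_incr _ (N - m)).
        + apply is_lim_seq_Reals, is_series_sum_f_R0, Hmom.
        + intros k. pose proof (Hr m). pose proof (pos_INR k).
          pose proof (ballot_pos (r m) k ltac:(lra)).
          apply Rmult_le_pos; [apply Rmult_le_pos|]; try apply pow_le; lra. }
    pose proof (Rabs_pos (sum_f_R0 (part m) (N - m))).
    replace (A * (w ^ m * ballot_moment (r m) 2 w))
      with (w ^ m * (A * ballot_moment (r m) 2 w)) by ring.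
    apply Rmult_le_compat; try lra; nra.
  - set (K := A * ((/ D ^ 2 + 8 * w / D ^ 3) * sqrt (1 + y))).
    assert (HD : 0 < D) by (apply Rdiv_lt_0_compat; lra).
    assert (HD2 : 0 < / D ^ 2) by (apply Rinv_0_lt_compat, pow_lt; lra).
    assert (HD3 : 0 < / D ^ 3) by (apply Rinv_0_lt_compat, pow_lt; lra).
    assert (Hs : 0 <= sqrt (1 + y)) by apply sqrt_pos.
    apply (@ex_series_le R_AbsRing R_CompleteNormedModule _
             (fun m => K * (r m ^ 2 * y ^ m))).
    + intros m. pose proof (Hr m).
      assert (Hym : 0 < y ^ m) by (apply pow_lt; lra).
      unfold w. rewrite ballot_moment_2_closed by (try exact Hy; lra).
      fold w. fold D.
      replace (A * (w ^ m * ((r m ^ 2 / D ^ 2 + 4 * w * r m / D ^ 3)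
                             * ballot_moment (r m) 0 w)))
        with (A * ((r m ^ 2 * / D ^ 2 + 4 * w * r m * / D ^ 3)
                             * (w ^ m * ballot_moment (r m) 0 w)))
        by (unfold Rdiv; ring).
      unfold w at 2 3, r at 3. rewrite ballot_moment_0_closed by exact Hy.
      match goal with |- norm ?x <= ?z => change (Rabs x <= z) end.
      assert (0 <= y ^ m * sqrt (1 + y)) by (apply Rmult_le_pos; lra).
      assert (0 <= r m ^ 2 * / D ^ 2) by (apply Rmult_le_pos; [apply pow_le|]; lra).
      assert (0 <= w * / D ^ 3) by (apply Rmult_le_pos; lra).
      assert (0 <= w * / D ^ 3 * r m) by (apply Rmult_le_pos; lra).
      assert (r m <= 2 * r m ^ 2) by nra.
      rewrite Rabs_pos_eq.
      * unfold K, Rdiv.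
        replace (A * ((/ D ^ 2 + 8 * w * / D ^ 3) * sqrt (1 + y)) * (r m ^ 2 * y ^ m))
          with (A * ((r m ^ 2 * / D ^ 2 + 4 * (w * / D ^ 3) * (2 * r m ^ 2))
                     * (y ^ m * sqrt (1 + y)))) by ring.
        apply Rmult_le_compat_l; [exact HA|].
        apply Rmult_le_compat_r; [assumption|]. nra.
      * apply Rmult_le_pos; [exact HA|]. apply Rmult_le_pos; [|assumption]. nra.
    + apply (ex_series_scal_l K (fun m => r m ^ 2 * y ^ m)).
      apply ex_series_ext with (fun m => 4 * ((INR m + / 4) ^ 2 * y ^ m)).
      { intros m. change (4 * ((INR m + / 4) ^ 2 * y ^ m) = r m ^ 2 * y ^ m).
        unfold r. field. }
      apply (ex_series_scal_l 4 (fun m => (INR m + / 4) ^ 2 * y ^ m)).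
      apply polynomial_geometric_summable; lra.
  - intros m. pose proof (Hr m).
    assert (Hval : (-1) ^ m * central m ^ 5 * w ^ m
      * (al * ballot_moment (r m) 2 w + be * ballot_moment (r m) 1 w
         + ga * ballot_moment (r m) 0 w)
      = ka * sqrt (1 + y) * ((-1) ^ m * central m ^ 5 * y ^ m
                   * (a * INR m ^ 2 + b * INR m + c))).
    { unfold w at 2 3 4.
      rewrite ballot_moment_2_closed, ballot_moment_1_closed
        by (try exact Hy; lra).
      fold w. fold D.
      transitivity ((-1) ^ m * central m ^ 5 * (w ^ m * ballot_moment (r m) 0 w)
        * (al * (r m ^ 2 / D ^ 2 + 4 * w * r m / D ^ 3)
           + be * (r m / D) + ga)); [unfold Rdiv; ring|].
      unfold r. unfold w at 1 2. rewrite ballot_moment_0_closed by exact Hy.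
      rewrite Hpoly. ring. }
    rewrite <- Hval. unfold d.
    apply is_lim_seq_mult'; [apply is_lim_seq_const|].
    apply (is_lim_seq_incr_n _ m).
    apply is_lim_seq_ext with (sum_f_R0 (part m)).
    { intros N. f_equal. lia. }
    apply is_series_sum_f_R0.
    apply is_series_ext with (fun k =>
      plus (plus (al * ((2 * INR k + r m) ^ 2 * ballot (r m) k * w ^ k))
                 (be * ((2 * INR k + r m) ^ 1 * ballot (r m) k * w ^ k)))
           (ga * ((2 * INR k + r m) ^ 0 * ballot (r m) k * w ^ k))).
    { intros k. unfold part, q, plus; simpl. ring. }
    repeat apply @is_series_plus; apply @is_series_scal_l with (K := R_AbsRing); apply Hmom.
  - apply (is_series_scal_l (ka * sqrt (1 + y))) in Hser. exact Hser.
Qed.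

(** Both sides are a(a+1)...(a+n). *)
Lemma rising_shift (a : R) (n : nat) :
  rising a n * (a + INR n) = a * rising (a + 1) n.
Proof.
  induction n as [|n IH]; [simpl; ring|].
  rewrite !rising_S, S_INR, IH. ring.
Qed.

Lemma ballot_closed (m j : nat) :
  ballot (2 * INR m + / 2) j
  = (4 * INR m + 1) * rising (/ 2) (2 * (m + j))
    / (INR (fact j) * rising (3 / 2) (m + j + m)).
Proof.
  pose proof (pos_INR m).
  induction j as [|j IH].
  - rewrite Nat.add_0_r. replace (m + m)%nat with (2 * m)%nat by lia.
    pose proof (rising_pos (3 / 2) (2 * m) ltac:(lra)).
    pose proof (rising_shift (/ 2) (2 * m)) as E.
    replace (/ 2 + 1) with (3 / 2) in E by field.
    rewrite mult_INR in E. simpl (INR 2) in E. simpl (INR (fact 0)).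
    change (ballot (2 * INR m + / 2) 0) with 1.
    apply (Rmult_eq_reg_r (rising (3 / 2) (2 * m))); [|lra].
    transitivity ((4 * INR m + 1) * rising (/ 2) (2 * m)); [lra|field; lra].
  - rewrite ballot_S, IH, fact_S_INR.
    replace (2 * (m + S j))%nat with (S (S (2 * (m + j)))) by lia.
    replace (m + S j + m)%nat with (S (m + j + m)) by lia.
    rewrite !rising_S, S_INR, mult_INR, !plus_INR. simpl (INR 2).
    pose proof (pos_INR j). pose proof (INR_fact_neq_0 j).
    pose proof (rising_pos (3 / 2) (m + j + m) ltac:(lra)).
    field. repeat split; lra.
Qed.

Lemma rising_half (n : nat) :
  INR (fact (2 * n)) = 4 ^ n * INR (fact n) * rising (/ 2) n.
Proof.
  induction n as [|n IH]; [simpl; ring|].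
  replace (2 * S n)%nat with (S (S (2 * n))) by lia.
  rewrite !fact_S_INR, IH, rising_S, S_INR, mult_INR.
  simpl (INR 2). simpl pow. field.
Qed.

(** In terms of rising factorials the inner sum is [whipple_sum] up to a factor
    depending on n only, so Whipple's transformation identifies it with U_n. *)
Lemma ballot_transform_eq_U (n : nat) :
  ballot_transform n
  = U n * (INR (fact (4 * n)) / (INR (fact n) ^ 2 * INR (fact (2 * n))))
    / 1024 ^ n.
Proof.
  rewrite U_eq_scaled, whipple_transformation.
  replace (4 * n)%nat with (2 * (2 * n))%nat by lia.
  rewrite (rising_half (2 * n)).
  pose proof (INR_fact_neq_0 n). pose proof (INR_fact_neq_0 (2 * n)).
  replace (1024 ^ n) with (64 ^ n * 4 ^ (2 * n))
    by (rewrite pow_mult, <- Rpow_mult_distr; f_equal; ring).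
  transitivity (rising (/ 2) (2 * n) / INR (fact n) ^ 2 * whipple_sum n).
  - unfold ballot_transform, whipple_sum. rewrite scal_sum. apply sum_eq. intros m Hm.
    rewrite ballot_closed. replace (m + (n - m))%nat with n by lia.
    unfold whipple_term.
    pose proof (INR_fact_neq_0 (n - m)).
    pose proof (rising_pos (3 / 2) (n + m) ltac:(lra)).
    field. repeat split; lra.
  - assert (64 ^ n <> 0) by (apply pow_nonzero; lra).
    assert (4 ^ (2 * n) <> 0) by (apply pow_nonzero; lra).
    field. tauto.
Qed.

(** * The Wilf-Zeilberger pair for Guillera's series *)

(** With rising factorials this is
    (-1)^n (1/2)_n^6 (1/2)_k^4 / ((n+k)!^4 (2n)!).  As a function of k it is the
    well-poised Dougall summand with parameters a = n + 1/2 and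
    b = c = d = e = 1/2; the factor 2n + 4k + 1 = 2(a + 2k) of [wz_F] is its
    very-well-poised part. *)
Definition wz_kernel (n k : nat) : R :=
  (-1) ^ n * central n ^ 5 * (/ 4) ^ n * central k ^ 4
  * (INR (fact n) * INR (fact k) / INR (fact (n + k))) ^ 4.

Definition wz_F (n k : nat) : R :=
  wz_kernel n k * (8 * INR n * (2 * INR n + 4 * INR k + 1)).

Definition wz_G (n k : nat) : R :=
  wz_kernel n k * (20 * INR n ^ 2 + 8 * INR n + 1 + 24 * INR k * INR n
                   + 8 * INR k ^ 2 + 4 * INR k).

Lemma wz_kernel_S_l (n k : nat) :
  wz_kernel (S n) k
  = - wz_kernel n k * ((2 * INR n + 1) / (2 * INR n + 2)) ^ 5 / 4
    * ((INR n + 1) / (INR n + INR k + 1)) ^ 4.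
Proof.
  unfold wz_kernel. change (S n + k)%nat with (S (n + k)).
  rewrite central_S, !fact_S_INR, plus_INR, <- !(tech_pow_Rmult _ n).
  pose proof (pos_INR n). pose proof (pos_INR k).
  pose proof (INR_fact_neq_0 (n + k)). field. lra.
Qed.

Lemma wz_kernel_S_r (n k : nat) :
  wz_kernel n (S k)
  = wz_kernel n k * ((2 * INR k + 1) / (2 * INR k + 2)) ^ 4
    * ((INR k + 1) / (INR n + INR k + 1)) ^ 4.
Proof.
  unfold wz_kernel. rewrite <- plus_n_Sm.
  rewrite central_S, !fact_S_INR, plus_INR.
  pose proof (pos_INR n). pose proof (pos_INR k).
  pose proof (INR_fact_neq_0 (n + k)). field. lra.
Qed.

Lemma wz_pair (n k : nat) :
  wz_G n (S k) - wz_G n k = wz_F (S n) k - wz_F n k.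
Proof.
  unfold wz_G, wz_F. rewrite wz_kernel_S_l, wz_kernel_S_r, !S_INR.
  pose proof (pos_INR n). pose proof (pos_INR k). field. lra.
Qed.

Lemma wz_F_0 (k : nat) : wz_F 0 k = 0.
Proof. unfold wz_F. simpl (INR 0). ring. Qed.

Definition wz_row (k N : nat) : R := sum_f_R0 (fun n => wz_G n k) N.

(** The sum over n of the pair relation telescopes; the lower end contributes
    nothing because [wz_F] carries a factor n. *)
Lemma wz_row_step (k N : nat) : wz_row (S k) N = wz_row k N + wz_F (S N) k.
Proof.
  unfold wz_row. induction N as [|N IH]; simpl sum_f_R0.
  - pose proof (wz_pair 0 k). rewrite wz_F_0 in *. lra.
  - rewrite IH. pose proof (wz_pair (S N) k). lra.
Qed.

Lemma wz_row_shift (K N : nat) :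
  wz_row (S K) N = wz_row 0 N + sum_f_R0 (wz_F (S N)) K.
Proof.
  induction K as [|K IH]; rewrite wz_row_step; [reflexivity|].
  rewrite IH. simpl. lra.
Qed.

(** The pair is a closed discrete form, so its sum along the staircase
    (0,0), (1,0), (1,1), (2,1), ..., (N+1,N+1) equals its sum along the column
    n = 0, where [wz_F] vanishes, followed by the row k = N+1. *)
Lemma wz_staircase (N : nat) :
  sum_f_R0 (fun n => wz_G n n + wz_F (S n) n) N = wz_row (S N) N.
Proof.
  induction N as [|N IH].
  - rewrite wz_row_step. reflexivity.
  - rewrite tech5, IH, (wz_row_step (S N) (S N)). unfold wz_row. rewrite tech5. ring.
Qed.

Lemma fact_quotient_bounds (n k : nat) :
  0 <= INR (fact n) * INR (fact k) / INR (fact (n + k)) <= 1.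
Proof.
  pose proof (INR_fact_lt_0 n). pose proof (INR_fact_lt_0 k).
  pose proof (INR_fact_lt_0 (n + k)).
  split.
  - apply Rlt_le, Rdiv_lt_0_compat; [now apply Rmult_lt_0_compat|assumption].
  - apply Rle_div_l; [assumption|]. rewrite Rmult_1_l, <- mult_INR.
    apply le_INR. clear. induction k as [|k IH].
    + rewrite Nat.add_0_r. simpl; lia.
    + rewrite <- plus_n_Sm, !fact_simpl. nia.
Qed.

(** For n >= 1 the binomial coefficient C(n+k, k) is at least k + 1; with the
    fourth power in [wz_kernel] this beats the quadratic factor of [wz_G]. *)
Lemma fact_quotient_decay (n k : nat) :
  INR (fact (S n)) * INR (fact k) / INR (fact (S n + k)) <= / (INR k + 1).
Proof.
  pose proof (INR_fact_lt_0 (S n + k)). pose proof (pos_INR k).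
  apply Rle_div_l; [assumption|].
  apply (Rmult_le_reg_l (INR k + 1)); [lra|].
  replace ((INR k + 1) * (/ (INR k + 1) * INR (fact (S n + k))))
    with (INR (fact (S n + k))) by (field; lra).
  rewrite <- S_INR, <- !mult_INR. apply le_INR. clear.
  change (S n + k)%nat with (S (n + k)).
  induction n as [|n IH].
  - simpl fact at 1. rewrite Nat.add_0_l, fact_simpl. lia.
  - rewrite (fact_simpl (S n)).
    change (S (S n + k)) with (S (S (n + k))). rewrite (fact_simpl (S (n + k))).
    nia.
Qed.

Lemma wz_kernel_bound (n k : nat) : Rabs (wz_kernel n k) <= (/ 4) ^ n.
Proof.
  pose proof (fact_quotient_bounds n k) as Hq.
  set (q := INR (fact n) * INR (fact k) / INR (fact (n + k))) in *.
  pose proof (central_pos n). pose proof (central_le_1 n).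
  pose proof (central_pos k). pose proof (central_le_1 k).
  assert (0 < (/ 4) ^ n) by (apply pow_lt; lra).
  unfold wz_kernel. fold q.
  rewrite !Rabs_mult, pow_1_abs, !Rabs_pos_eq
    by (try apply pow_le; lra).
  assert (0 <= central n ^ 5 <= 1)
    by (split; [apply pow_le; lra|rewrite <- (pow1 5); apply pow_incr; lra]).
  assert (0 <= central k ^ 4 <= 1)
    by (split; [apply pow_le; lra|rewrite <- (pow1 4); apply pow_incr; lra]).
  assert (0 <= q ^ 4 <= 1)
    by (split; [apply pow_le; lra|rewrite <- (pow1 4); apply pow_incr; lra]).
  assert (0 <= central n ^ 5 * central k ^ 4 <= 1) by nra.
  assert (0 <= central n ^ 5 * central k ^ 4 * q ^ 4 <= 1) by nra.
  nra.
Qed.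

Lemma wz_kernel_decay (n k : nat) :
  Rabs (wz_kernel (S n) k) <= (/ 4) ^ S n / (INR k + 1) ^ 4.
Proof.
  pose proof (fact_quotient_bounds (S n) k) as Hq.
  pose proof (fact_quotient_decay n k) as Hd.
  set (q := INR (fact (S n)) * INR (fact k) / INR (fact (S n + k))) in *.
  pose proof (central_pos (S n)). pose proof (central_le_1 (S n)).
  pose proof (central_pos k). pose proof (central_le_1 k). pose proof (pos_INR k).
  assert (0 < (/ 4) ^ S n) by (apply pow_lt; lra).
  unfold wz_kernel. fold q.
  rewrite !Rabs_mult, pow_1_abs, !Rabs_pos_eq
    by (try apply pow_le; lra).
  assert (0 <= central (S n) ^ 5 <= 1)
    by (split; [apply pow_le; lra|rewrite <- (pow1 5); apply pow_incr; lra]).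
  assert (0 <= central k ^ 4 <= 1)
    by (split; [apply pow_le; lra|rewrite <- (pow1 4); apply pow_incr; lra]).
  assert (0 <= q ^ 4 <= / (INR k + 1) ^ 4)
    by (split; [apply pow_le; lra|rewrite <- pow_inv; apply pow_incr; lra]).
  assert (0 <= central (S n) ^ 5 * central k ^ 4 <= 1) by nra.
  unfold Rdiv.
  replace (1 * central (S n) ^ 5 * (/ 4) ^ S n * central k ^ 4 * q ^ 4)
    with ((/ 4) ^ S n * (central (S n) ^ 5 * central k ^ 4 * q ^ 4)) by ring.
  apply Rmult_le_compat_l; [lra|]. nra.
Qed.

(** * Wallis' product *)

Definition wallis (n : nat) : R := RInt (fun x => sin x ^ n) 0 (PI / 2).

Lemma continuous_sin_pow (n : nat) (x : R) :
  continuous (fun x => sin x ^ n) x.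
Proof.
  apply (ex_derive_continuous (V := R_NormedModule)). auto_derive. trivial.
Qed.

Lemma ex_RInt_sin_pow (n : nat) : ex_RInt (fun x => sin x ^ n) 0 (PI / 2).
Proof. apply (ex_RInt_continuous (V := R_CompleteNormedModule)).
  intros; apply continuous_sin_pow. Qed.

Lemma wallis_0 : wallis 0 = PI / 2.
Proof.
  unfold wallis. simpl pow. rewrite RInt_const. unfold scal; simpl.
  unfold mult; simpl. ring.
Qed.

Lemma wallis_1 : wallis 1 = 1.
Proof.
  unfold wallis. apply is_RInt_unique.
  replace 1 with (minus (- cos (PI / 2)) (- cos 0))
    by (rewrite cos_PI2, cos_0; unfold minus, plus, opp; simpl; ring).
  apply (is_RInt_derive (fun x => - cos x)).
  - intros x _. auto_derive; [trivial|ring].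
  - intros x _. apply continuous_sin_pow.
Qed.

(** Integrate the derivative of - cos x * sin x ^ (n+1), which vanishes at both
    ends of the interval. *)
Lemma wallis_recurrence (n : nat) :
  (INR n + 2) * wallis (S (S n)) = (INR n + 1) * wallis n.
Proof.
  assert (H : is_RInt (fun x => (INR n + 2) * sin x ^ S (S n)
                                - (INR n + 1) * sin x ^ n) 0 (PI / 2) 0).
  { replace 0 with (minus (- (cos (PI / 2) * sin (PI / 2) ^ S n))
                          (- (cos 0 * sin 0 ^ S n))) at 2
      by (rewrite cos_PI2, sin_0; unfold minus, plus, opp; simpl; ring).
    apply (is_RInt_derive (fun x => - (cos x * sin x ^ S n))).
    - intros x _. remember (S n) as p eqn:Hp. auto_derive; [trivial|].
      rewrite Hp. change (Nat.pred (S n)) with n.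
      pose proof (sin2_cos2 x) as E. unfold Rsqr in E.
      rewrite <- !tech_pow_Rmult, S_INR.
      transitivity (sin x ^ n * (sin x * sin x - (INR n + 1) * (cos x * cos x))).
      + ring.
      + replace (cos x * cos x) with (1 - sin x * sin x) by lra. ring.
    - intros x _. apply (ex_derive_continuous (V := R_NormedModule)).
      auto_derive. trivial. }
  assert (H' : is_RInt (fun x => (INR n + 2) * sin x ^ S (S n)
                                - (INR n + 1) * sin x ^ n) 0 (PI / 2)
                 ((INR n + 2) * wallis (S (S n)) - (INR n + 1) * wallis n)).
  { apply (is_RInt_minus (V := R_NormedModule)
             (fun x => (INR n + 2) * sin x ^ S (S n))
             (fun x => (INR n + 1) * sin x ^ n));
      [apply (is_RInt_scal (fun x => sin x ^ S (S n)))
      |apply (is_RInt_scal (fun x => sin x ^ n))];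
      apply (RInt_correct (V := R_CompleteNormedModule)), ex_RInt_sin_pow. }
  apply (is_RInt_unique (V := R_CompleteNormedModule)) in H.
  apply (is_RInt_unique (V := R_CompleteNormedModule)) in H'.
  lra.
Qed.

Lemma wallis_decreasing (n : nat) : wallis (S n) <= wallis n.
Proof.
  pose proof PI_RGT_0. apply RInt_le; [lra|apply ex_RInt_sin_pow..|].
  intros x Hx.
  assert (0 <= sin x) by (apply sin_ge_0; lra).
  pose proof (SIN_bound x). pose proof (pow_le (sin x) n ltac:(assumption)).
  simpl. nra.
Qed.

Lemma wallis_even (n : nat) : wallis (2 * n) = PI / 2 * central n.
Proof.
  induction n as [|n IH].
  { change (wallis 0 = PI / 2 * 1). rewrite wallis_0. ring. }
  replace (2 * S n)%nat with (S (S (2 * n))) by lia.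
  pose proof (wallis_recurrence (2 * n)) as E. rewrite IH in E.
  rewrite mult_INR in E. change (INR 2) with 2 in E. pose proof (pos_INR n).
  rewrite central_S. apply (Rmult_eq_reg_l (2 * INR n + 2)); [|lra].
  rewrite E. field. lra.
Qed.

Lemma wallis_odd (n : nat) :
  wallis (S (2 * n)) = / ((2 * INR n + 1) * central n).
Proof.
  induction n as [|n IH].
  { change (wallis 1 = / ((2 * 0 + 1) * 1)). rewrite wallis_1. field. }
  replace (S (2 * S n))%nat with (S (S (S (2 * n)))) by lia.
  pose proof (wallis_recurrence (S (2 * n))) as E. rewrite IH in E.
  rewrite S_INR, mult_INR in E. change (INR 2) with 2 in E. pose proof (pos_INR n).
  pose proof (central_pos n).
  rewrite central_S, S_INR. apply (Rmult_eq_reg_l (2 * INR n + 1 + 2)); [|lra].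
  rewrite E. field. repeat split; lra.
Qed.

(** Wallis' product: even and odd sine integrals are [central] and its
    reciprocal up to elementary factors, and they interlace because the
    integrals decrease. *)
Lemma central_square_limit :
  is_lim_seq (fun n => central n ^ 2 * (2 * INR n + 1)) (2 / PI).
Proof.
  pose proof PI_RGT_0 as HPI.
  apply is_lim_seq_le_le with
    (u := fun _ => 2 / PI)
    (w := fun n => 2 / PI * ((INR n + 1) / (INR n + / 2))).
  - intros n. pose proof (pos_INR n). pose proof (central_pos n) as Hu. split.
    + pose proof (wallis_decreasing (2 * n)) as Hd.
      rewrite wallis_even, wallis_odd in Hd.
      assert (0 < (2 * INR n + 1) * central n) by nra.
      apply Rle_div_l; [exact HPI|].
      apply (Rmult_le_compat_l (2 * ((2 * INR n + 1) * central n))) in Hd; [|nra].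
      replace (2 * ((2 * INR n + 1) * central n) * / ((2 * INR n + 1) * central n))
        with 2 in Hd by (field; lra).
      nra.
    + pose proof (wallis_decreasing (S (2 * n))) as Hd.
      replace (S (S (2 * n))) with (2 * S n)%nat in Hd by lia.
      rewrite wallis_even, wallis_odd, central_S in Hd.
      assert (0 < (2 * INR n + 1) * central n) by nra.
      apply (Rmult_le_compat_l (2 / PI * ((2 * INR n + 2) * central n))) in Hd;
        [|apply Rmult_le_pos; [apply Rlt_le, Rdiv_lt_0_compat; lra|nra]].
      replace (2 / PI * ((2 * INR n + 2) * central n) *
        (PI / 2 * (central n * ((2 * INR n + 1) / (2 * INR n + 2)))))
        with (central n ^ 2 * (2 * INR n + 1)) in Hd by (field; lra).
      eapply Rle_trans; [exact Hd|]. right. field. lra.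
  - apply is_lim_seq_const.
  - replace (Finite (2 / PI)) with (Finite (2 / PI * 1)) by (f_equal; ring).
    apply is_lim_seq_mult'; [apply is_lim_seq_const|].
    apply lim_shift_quotient. lra.
Qed.

(** * Guillera's series *)

(** The quadratic factor 8n^2 + 4n + 1 is asymptotically twice (2n+1)^2, and
    the fourth power of [central] is asymptotically 4 / (PI^2 (2n+1)^2). *)
Lemma wz_G_0_limit : is_lim_seq (wz_G 0) (8 / PI ^ 2).
Proof.
  apply is_lim_seq_ext with (fun n =>
    (central n ^ 2 * (2 * INR n + 1)) ^ 2
    * (2 - (INR n + / 4) / (INR n + / 2) * / (INR n + / 2))).
  - intros n. unfold wz_G, wz_kernel. rewrite Nat.add_0_l.
    pose proof (INR_fact_neq_0 n). pose proof (pos_INR n).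
    change (INR 0) with 0. change (INR (fact 0)) with 1.
    change (central 0) with 1. rewrite !pow_O. field. split; lra.
  - replace (Finite (8 / PI ^ 2))
      with (Finite ((2 / PI) ^ 2 * (2 - 1 * 0)))
      by (f_equal; field; apply PI_neq0).
    apply is_lim_seq_mult'; [apply lim_pow, central_square_limit|].
    apply is_lim_seq_minus'; [apply is_lim_seq_const|].
    apply is_lim_seq_mult'.
    + apply lim_shift_quotient; lra.
    + apply lim_inv_shift. lra.
Qed.

(** The constant 65 = 20 + 8 + 1 + 24 + 8 + 4 bounds the quadratic factor of
    [wz_G] by 65 (k+1)^2 when n <= k; the other factor sums the geometric
    series of ratio 1/4 generously. *)
Lemma wz_row_tail_bound (k M : nat) :
  (M <= k)%nat ->
  Rabs (wz_row k M - wz_G 0 k) <= 65 / (INR k + 1) ^ 2 * (1 - (/ 4) ^ M).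
Proof.
  pose proof (pos_INR k) as Hk.
  assert (Hc : 0 < 65 / (INR k + 1) ^ 2)
    by (apply Rdiv_lt_0_compat; [lra|apply pow_lt; lra]).
  induction M as [|M IH]; intros HM.
  - unfold wz_row. simpl sum_f_R0. rewrite Rminus_diag, Rabs_R0. simpl. lra.
  - unfold wz_row. rewrite tech5. fold (wz_row k M).
    replace (wz_row k M + wz_G (S M) k - wz_G 0 k)
      with ((wz_row k M - wz_G 0 k) + wz_G (S M) k) by ring.
    eapply Rle_trans; [apply Rabs_triang|].
    pose proof (IH ltac:(lia)).
    assert (Rabs (wz_G (S M) k) <= 65 / (INR k + 1) ^ 2 * (/ 4) ^ S M).
    { unfold wz_G. rewrite Rabs_mult.
      pose proof (le_INR _ _ HM) as Hle. pose proof (pos_INR (S M)) as HS.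
      set (x := INR (S M)) in *. set (z := INR k) in *.
      assert (0 <= 20 * x ^ 2 + 8 * x + 1 + 24 * z * x + 8 * z ^ 2 + 4 * z
              <= 65 * (z + 1) ^ 2) as Hq.
      { assert (0 <= x * z) by now apply Rmult_le_pos.
        assert (x * z <= z * z) by (apply Rmult_le_compat_r; lra).
        assert (x * x <= z * z) by (apply Rmult_le_compat; lra).
        nra. }
      rewrite (Rabs_pos_eq (20 * x ^ 2 + _ + _ + _ + _ + _)) by lra.
      pose proof (wz_kernel_decay M k) as Hd. fold z in Hd.
      apply Rle_trans with ((/ 4) ^ S M / (z + 1) ^ 4 * (65 * (z + 1) ^ 2)).
      - apply Rmult_le_compat; try lra. apply Rabs_pos.
      - right. field. lra. }
    assert (HqM : 0 < (/ 4) ^ M) by (apply pow_lt; lra).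
    pose proof (Rmult_lt_0_compat _ _ Hc HqM).
    change ((/ 4) ^ S M) with (/ 4 * (/ 4) ^ M) in *. lra.
Qed.

Lemma lim_inv_square (c : R) :
  is_lim_seq (fun N => c / (INR N + 1) ^ 2) 0.
Proof.
  replace (Finite 0) with (Finite (c * 0 ^ 2)) by (f_equal; ring).
  apply is_lim_seq_ext with (fun N => c * (/ (INR N + 1)) ^ 2).
  { intros N. pose proof (pos_INR N). field. lra. }
  apply is_lim_seq_mult'; [apply is_lim_seq_const|].
  apply lim_pow, lim_inv_shift. lra.
Qed.

(** Far up, only the term n = 0 of a row survives. *)
Lemma wz_row_diagonal_limit :
  is_lim_seq (fun N => wz_row (S N) N) (8 / PI ^ 2).
Proof.
  apply is_lim_seq_ext with
    (fun N => wz_G 0 (S N) + (wz_row (S N) N - wz_G 0 (S N))).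
  { intros N. ring. }
  replace (Finite (8 / PI ^ 2)) with (Finite (8 / PI ^ 2 + 0))
    by (f_equal; ring).
  apply is_lim_seq_plus'; [apply (is_lim_seq_incr_1 (wz_G 0)), wz_G_0_limit|].
  apply is_lim_seq_abs_0.
  apply is_lim_seq_le_le with (u := fun _ => 0)
    (w := fun N => 65 / (INR (S N) + 1) ^ 2).
  - intros N. split; [apply Rabs_pos|].
    pose proof (wz_row_tail_bound (S N) N ltac:(lia)) as Hb.
    pose proof (pos_INR (S N)).
    assert (0 < 65 / (INR (S N) + 1) ^ 2)
      by (apply Rdiv_lt_0_compat; [lra|apply pow_lt; lra]).
    assert (0 < (/ 4) ^ N) by (apply pow_lt; lra). nra.
  - apply is_lim_seq_const.
  - apply (is_lim_seq_incr_1 (fun N => 65 / (INR N + 1) ^ 2)), lim_inv_square.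
Qed.

Lemma wz_F_sum_limit :
  is_lim_seq (fun N => sum_f_R0 (wz_F (S N)) N) 0.
Proof.
  apply is_lim_seq_abs_0.
  apply is_lim_seq_le_le with (u := fun _ => 0)
    (w := fun N => 12 * ((INR N + 1) ^ 3 * (/ 4) ^ N)).
  - intros N. split; [apply Rabs_pos|].
    eapply Rle_trans; [apply Rsum_abs|].
    apply Rle_trans with
      (sum_f_R0 (fun _ => 12 * ((INR N + 1) ^ 2 * (/ 4) ^ N)) N).
    + apply sum_Rle. intros k Hk. unfold wz_F. rewrite Rabs_mult, S_INR.
      apply le_INR in Hk. pose proof (pos_INR k).
      pose proof (wz_kernel_bound (S N) k) as Hb.
      rewrite <- tech_pow_Rmult in Hb.
      assert (0 <= 8 * (INR N + 1) * (2 * (INR N + 1) + 4 * INR k + 1)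
              <= 48 * (INR N + 1) ^ 2) as Hq.
      { split; [apply Rmult_le_pos; lra|].
        replace (48 * (INR N + 1) ^ 2)
          with (8 * (INR N + 1) * (6 * (INR N + 1))) by ring.
        apply Rmult_le_compat_l; lra. }
      rewrite (Rabs_pos_eq (8 * _ * _)) by lra.
      replace (12 * ((INR N + 1) ^ 2 * (/ 4) ^ N))
        with (/ 4 * (/ 4) ^ N * (48 * (INR N + 1) ^ 2)) by field.
      apply Rmult_le_compat; try lra. apply Rabs_pos.
    + rewrite sum_cte, S_INR. right. ring.
  - apply is_lim_seq_const.
  - replace (Finite 0) with (Finite (12 * 0)) by (f_equal; ring).
    apply is_lim_seq_mult'; [apply is_lim_seq_const|].
    apply ex_series_lim_0, polynomial_geometric_summable; lra.
Qed.

(** The bottom row k = 0, reached from the row k = N + 1 through the column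
    n = N + 1, whose contribution is O(N^3 / 4^N). *)
Lemma guillera_20 :
  is_series (fun m => (-1) ^ m * central m ^ 5 * (/ 4) ^ m
                      * (20 * INR m ^ 2 + 8 * INR m + 1)) (8 / PI ^ 2).
Proof.
  apply is_series_sum_f_R0.
  apply is_lim_seq_ext with
    (fun N => wz_row (S N) N - sum_f_R0 (wz_F (S N)) N).
  - intros N. rewrite wz_row_shift.
    transitivity (wz_row 0 N); [ring|]. unfold wz_row. apply sum_eq.
    intros m _. unfold wz_G, wz_kernel. rewrite Nat.add_0_r.
    pose proof (INR_fact_neq_0 m).
    change (INR 0) with 0. change (INR (fact 0)) with 1. change (central 0) with 1.
    field. assumption.
  - replace (Finite (8 / PI ^ 2)) with (Finite (8 / PI ^ 2 - 0))
      by (f_equal; ring).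
    apply is_lim_seq_minus'; [apply wz_row_diagonal_limit|apply wz_F_sum_limit].
Qed.

Lemma wz_kernel_diagonal (n : nat) :
  wz_kernel n n = (-1) ^ n * central n ^ 5 * (/ 1024) ^ n.
Proof.
  unfold wz_kernel.
  pose proof (central_binomial n) as E. unfold Binomial.C in E.
  replace (2 * n - n)%nat with n in E by lia.
  replace (n + n)%nat with (2 * n)%nat by lia.
  pose proof (INR_fact_neq_0 n). pose proof (INR_fact_neq_0 (2 * n)).
  pose proof (central_pos n).
  assert (4 ^ n <> 0) by (apply pow_nonzero; lra).
  replace (INR (fact n) * INR (fact n) / INR (fact (2 * n)))
    with (/ (4 ^ n * central n)) by (rewrite <- E; field; tauto).
  replace (/ 1024) with ((/ 4) ^ 5) by field.
  rewrite <- pow_mult, Nat.mul_comm, pow_mult, !pow_inv. field.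
  split; [assumption|lra].
Qed.

(** The staircase sum: on the diagonal C(2n,n)^4 appears in the denominator and
    improves the ratio from 1/4 to 1/1024. *)
Lemma guillera_820 :
  is_series (fun m => (-1) ^ m * central m ^ 5 * (/ 1024) ^ m
                      * (820 * INR m ^ 2 + 180 * INR m + 13)) (128 / PI ^ 2).
Proof.
  apply is_series_sum_f_R0.
  apply is_lim_seq_ext with (fun N => 16 * wz_row (S N) N).
  - intros N. rewrite <- wz_staircase, scal_sum. apply sum_eq. intros n _.
    unfold wz_G, wz_F. rewrite wz_kernel_S_l, wz_kernel_diagonal, S_INR.
    pose proof (pos_INR n). field. lra.
  - replace (Finite (128 / PI ^ 2)) with (Finite (16 * (8 / PI ^ 2)))
      by (f_equal; field; apply PI_neq0).
    apply is_lim_seq_mult'; [apply is_lim_seq_const|apply wz_row_diagonal_limit].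
Qed.

(** * The series for U *)

(** The transformation at y = 1/4, w = 4/25, where w/1024 = 1/6400.  The weight
    18n^2 - 10n - 3 is rewritten in the variable 2n + 1/2. *)
Lemma U_series_20 :
  is_series
    (fun n : nat =>
       U n * (INR (fact (4 * n)) / (INR (fact n) ^ 2 * INR (fact (2 * n))))
       * ((18 * INR n ^ 2 - 10 * INR n - 3) / (2 ^ 8 * 5 ^ 2) ^ n))
    (10 * sqrt 5 / PI ^ 2).
Proof.
  replace (10 * sqrt 5 / PI ^ 2)
    with (5 / 2 * sqrt (1 + / 4) * (8 / PI ^ 2)).
  2:{ replace (1 + / 4) with (5 / 2 ^ 2) by field.
      rewrite sqrt_div_alt, sqrt_pow2 by lra. field. apply PI_neq0. }
  apply is_series_ext with (fun n =>
    ballot_transform n * catalan_argument (/ 4) ^ n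
      * (9 / 2 * (2 * INR n + / 2) ^ 2 + - (19 / 2) * (2 * INR n + / 2)
         + 5 / 8)).
  { intros n. match goal with |- ?a = ?b => change (a = b :> R) end.
    rewrite ballot_transform_eq_U.
    replace (catalan_argument (/ 4)) with (1024 * / (2 ^ 8 * 5 ^ 2))
      by (unfold catalan_argument; field).
    rewrite Rpow_mult_distr, pow_inv.
    assert (1024 ^ n <> 0) by (apply pow_nonzero; lra).
    assert ((2 ^ 8 * 5 ^ 2) ^ n <> 0) by (apply pow_nonzero; lra).
    pose proof (INR_fact_neq_0 n). pose proof (INR_fact_neq_0 (2 * n)).
    field. tauto. }
  apply ballot_transform_series with (a := 20) (b := 8) (c := 1); [lra| |].
  - intros x. unfold catalan_argument. field.
  - exact guillera_20.
Qed.

(** The transformation at y = 1/1024, w = 1024/1025^2, where w/1024 is the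
    reciprocal of 1025^2 = 5^4 41^2. *)
Lemma U_series_820 :
  is_series
    (fun n : nat =>
       U n * (INR (fact (4 * n)) / (INR (fact n) ^ 2 * INR (fact (2 * n))))
       * ((1046529 * INR n ^ 2 + 227104 * INR n + 16032)
          / (5 ^ 4 * 41 ^ 2) ^ n))
    (5 ^ 4 * 41 * sqrt 41 / PI ^ 2).
Proof.
  replace (5 ^ 4 * 41 * sqrt 41 / PI ^ 2)
    with (5125 / 4 * sqrt (1 + / 1024) * (128 / PI ^ 2)).
  2:{ replace (1 + / 1024) with (5 ^ 2 * 41 / 32 ^ 2) by field.
      rewrite sqrt_div_alt, sqrt_mult_alt, !sqrt_pow2 by lra.
      field. apply PI_neq0. }
  apply is_series_ext with (fun n =>
    ballot_transform n * catalan_argument (/ 1024) ^ n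
      * (1046529 / 4 * (2 * INR n + / 2) ^ 2
         + (227104 / 2 - 1046529 / 4) * (2 * INR n + / 2)
         + (16032 - 227104 / 4 + 1046529 / 16))).
  { intros n. match goal with |- ?a = ?b => change (a = b :> R) end.
    rewrite ballot_transform_eq_U.
    replace (catalan_argument (/ 1024)) with (1024 * / (5 ^ 4 * 41 ^ 2))
      by (unfold catalan_argument; field).
    rewrite Rpow_mult_distr, pow_inv.
    assert (1024 ^ n <> 0) by (apply pow_nonzero; lra).
    assert ((5 ^ 4 * 41 ^ 2) ^ n <> 0) by (apply pow_nonzero; lra).
    pose proof (INR_fact_neq_0 n). pose proof (INR_fact_neq_0 (2 * n)).
    field. tauto. }
  apply ballot_transform_series with (a := 820) (b := 180) (c := 13); [lra| |].
  - intros x. unfold catalan_argument. field.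
  - exact guillera_820.
Qed.

Lemma U_recurrence (n : nat) :
  (1 <= n)%nat ->
  (INR n + 1) ^ 3 * U (n + 1)
  - 8 * (2 * INR n + 1) * (8 * INR n ^ 2 + 8 * INR n + 5) * U n
  + 4096 * INR n ^ 3 * U (n - 1) = 0.
Proof.
  intros Hn. destruct n as [|p]; [lia|].
  replace (S p + 1)%nat with (S (S p)) by lia.
  replace (S p - 1)%nat with p by lia.
  rewrite !U_eq_scaled, S_INR, <- !tech_pow_Rmult.
  pose proof (U_scaled_recurrence p) as E. unfold second_coeff in E.
  transitivity (4096 * 64 ^ p
    * ((INR p + 2) ^ 3 * U_scaled (S (S p))
       - (2 * (INR p + 1) + 1) * (8 * (INR p + 1) ^ 2 + 8 * (INR p + 1) + 5) / 8
         * U_scaled (S p)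
       + (INR p + 1) ^ 3 * U_scaled p)); [field|]. rewrite E. ring.
Qed.

Theorem theorem3 :
  (forall n : nat, exists z : Z, U n = IZR z) /\
  is_series
    (fun n : nat =>
       U n * (INR (fact (4 * n)) / (INR (fact n) ^ 2 * INR (fact (2 * n))))
       * ((18 * INR n ^ 2 - 10 * INR n - 3) / (2 ^ 8 * 5 ^ 2) ^ n))
    (10 * sqrt 5 / PI ^ 2) /\
  is_series
    (fun n : nat =>
       U n * (INR (fact (4 * n)) / (INR (fact n) ^ 2 * INR (fact (2 * n))))
       * ((1046529 * INR n ^ 2 + 227104 * INR n + 16032)
          / (5 ^ 4 * 41 ^ 2) ^ n))
    (5 ^ 4 * 41 * sqrt 41 / PI ^ 2) /\
  (forall n : nat, (1 <= n)%nat ->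
     (INR n + 1) ^ 3 * U (n + 1)
     - 8 * (2 * INR n + 1) * (8 * INR n ^ 2 + 8 * INR n + 5) * U n
     + 4096 * INR n ^ 3 * U (n - 1) = 0).
Proof.
  exact (conj U_integer (conj U_series_20 (conj U_series_820 U_recurrence))).
Qed.
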